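(* Let $G$ be a connected graph with $k$ edges, where $k\ge 2$ is fixed. Then $f(n,G)\le \frac{2^n}{2(k-1)}\left(1+O\left(\frac{1}{\sqrt n}\right)\right)$.
   Context: $[n]=\{1,\dots,n\}$ and $\mathcal{P}(n)$ is the set of all subsets of $[n]$. Graphs are finite and simple. For a graph $G$, a hypergraph $H$ is called Berge-$G$ if there is a copy of $G$ with $V(G)\subseteq V(H)$ and a bijection $g:E(G)\to E(H)$ such that $e\subseteq g(e)$ for every $e\in E(G)$. A family of subsets of $[n]$ (viewed as a hypergraph with vertex set $[n]$) is $G$-free if it contains no subfamily that is a Berge-$G$ hypergraph. $f(n,G)$ denotes the smallest number of colors in a coloring (partition) of $\mathcal{P}(n)$ such that every color class is $G$-free. The asymptotic notation is for $n\to\infty$ with $G$ (hence $k$) fixed; the implied constant may depend on $k$. *)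

(* Defs.v *)
From mathcomp Require Import all_boot.

Set Implicit Arguments.
Unset Strict Implicit.
Unset Printing Implicit Defensive.

Record sgraph := SGraph {
  vertex :> finType;
  adj : rel vertex;
  adj_sym : symmetric adj;
  adj_irrefl : irreflexive adj
}.

Section SimpleGraph.
Variable G : sgraph.

Definition edges : {set {set G}} := [set [set p.1; p.2] | p : G * G & adj p.1 p.2].

Definition connected_graph : Prop :=
  0 < #|G| /\ forall x y : G, connect (@adj G) x y.

End SimpleGraph.

Section Berge.
Variables (G : sgraph) (T : finType).
Implicit Types H F : {set {set T}}.

(* [phi] is the copy of [G] inside the vertex set [T] of [H].  The map [g]
   matters only on [edges G], which it sends bijectively onto [H]. *)
Definition berge H : bool :=
  [exists phi : {ffun G -> T}, injectiveb phi &&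
  [exists g : {ffun {set G} -> {set T}},
    [&& dinjectiveb g (edges G),
        g @: edges G == H &
        [forall e in edges G, phi @: e \subset g e]]]].

Definition berge_free F : bool :=
  ~~ [exists H : {set {set T}}, (H \subset F) && berge H].

Definition free_coloring (P : {set {set {set T}}}) : bool :=
  partition P [set: {set T}] && [forall F in P, berge_free F].

(* The partition of the power set into singletons. *)
Definition discrete_coloring : {set {set {set T}}} :=
  [set [set A] | A : {set T}].

End Berge.

(* The discrete coloring only serves as the starting point required by
   [arg min]; it is a valid coloring as soon as [G] has two edges (see
   [discrete_coloring_free]), and then [f_berge n G] is the true minimum
   (see [f_bergeP]). *)
Definition f_berge (n : nat) (G : sgraph) : nat :=
  #|[arg min_(P < discrete_coloring 'I_n | free_coloring G P) #|P|]|.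

Lemma discrete_coloring_free (G : sgraph) (T : finType) :
  1 < #|edges G| -> free_coloring G (discrete_coloring T).
Proof.
move=> G2; apply/andP; split.
  apply/and3P; split.
  - apply/eqP/setP => A; rewrite inE; apply/bigcupP.
    by exists [set A]; rewrite ?imset_f ?set11.
  - apply/trivIsetP => _ _ /imsetP[A _ ->] /imsetP[B _ ->] AB.
    rewrite -setI_eq0; apply/eqP/setP => C; rewrite !inE.
    by apply/negP => /andP[/eqP-> /eqP CB]; rewrite CB eqxx in AB.
  - by apply/imsetP => -[A _ /setP/(_ A)]; rewrite !inE eqxx.
apply/forall_inP => _ /imsetP[A _ ->]; apply/existsP => -[H /andP[HA]].
case/existsP => phi /andP[_ /existsP[g /and3P[/dinjectiveP ginj /eqP gH _]]].
have := subset_leq_card HA; rewrite -gH card_in_imset // cards1.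
by move: G2; rewrite ltnNge => /negP.
Qed.

Lemma f_bergeP (n : nat) (G : sgraph) : 1 < #|edges G| ->
  (exists2 P : {set {set {set 'I_n}}}, free_coloring G P & #|P| = f_berge n G)
  /\ (forall P : {set {set {set 'I_n}}}, free_coloring G P -> f_berge n G <= #|P|).
Proof.
move=> /(discrete_coloring_free 'I_n) G2; rewrite /f_berge.
by case: arg_minnP => // P PG Pmin; split; [exists P | exact: Pmin].
Qed.

(* Main.v *)
Require Import Defs.
From mathcomp Require Import all_boot all_order all_algebra.
From mathcomp Require Import all_classical all_reals all_analysis.
From mathcomp Require Import zify ring lra.
Import Order.TTheory GRing.Theory Num.Theory.
Import numFieldNormedType.Exports.
Local Open Scope classical_set_scope.
Local Open Scope ring_scope.

(** Let d = k - 1.  Two families of at most d sets each, every member of the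
    first disjoint from every member of the second, form together a G-free
    family: connectedness of G forces a Berge copy of G to live on one side
    ([berge_free_disjointU]), and k edges do not fit there.  So 2d sets may
    share a color, and the point is to partition almost all of the power set
    of [n] into such pairs of families.

    Fix a point x0.  The subsets avoiding x0 are partitioned into
    C(n-1, (n-1)/2) symmetric chains
    ([symmetric_chain_decomposition]); the complements of the members of a
    chain, which are the sets containing x0, form a chain again.  Cut each chain
    A_0 < A_1 < ... into blocks of d consecutive members, and match the block
    A_i, ..., A_(i+d-1) with the d complements of A_(i+d-1), ..., A_(i+2d-2).
    These contain A_(i+d-1), hence the whole block, before complementation, so
    the two families are cross-disjoint.  A chain with m members spends at most
    m / d + 2 colors, so all chains together spend at most
    2^(n-1) / d + 2 C(n-1, (n-1)/2) colors ([card_chain_color]).  The central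
    binomial coefficient is at most 2^(n-1) / sqrt n
    ([central_binomial_le_sqrt]), which makes the second term a relative error
    of 2 d / sqrt n. *)

(** * Families that contain no Berge copy of a connected graph *)

Section SetFamilies.
(* Within this section, names such as [cover] and [closed] denote the notions on
   finite sets and finite graphs, not those on classical sets and topologies. *)
Import mathcomp.boot.all_boot.
Local Close Scope ring_scope.
Local Close Scope classical_set_scope.

(** In a Berge copy of G, the vertices sent into the union U of F1 are closed
    under adjacency, because an edge assigned to F1 has both ends in U and an
    edge assigned to F2 has none.  Hence all edges are assigned to the same
    side, which is too small to receive them injectively. *)
Lemma berge_free_disjointU (G : sgraph) (T : finType) (F1 F2 : {set {set T}}) :
  connected_graph G -> #|F1| < #|edges G| -> #|F2| < #|edges G| ->
  (forall A B, A \in F1 -> B \in F2 -> [disjoint A & B]) ->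
  berge_free G (F1 :|: F2).
Proof.
move=> [_ Gconn] F1lt F2lt F12; apply/existsP => -[H /andP[/subsetP HF]].
case/existsP => phi /andP[_ /existsP[g /and3P[/dinjectiveP ginj /eqP gH]]].
move/forall_inP => phig.
have gF e : e \in edges G -> (g e \in F1) || (g e \in F2).
  by move=> eG; move: (HF (g e)); rewrite -gH imset_f // inE; apply.
pose U := cover F1.
have edgeU e u : e \in edges G -> u \in e -> (phi u \in U) = (g e \in F1).
  move=> eG ue; have phiu : phi u \in g e.
    by apply: (subsetP (phig e eG)); rewrite imset_f.
  apply/idP/idP => [/bigcupP[A AF1 phiuA]|geF1]; last first.
    by apply/bigcupP; exists (g e).
  have /orP[//|geF2] := gF _ eG.
  by have /pred0P/(_ (phi u)) := F12 _ _ AF1 geF2; rewrite /= phiuA phiu.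
have adjU u v : adj u v -> (phi u \in U) = (phi v \in U).
  move=> uv; have eG : [set u; v] \in edges G.
    by apply/imsetP; exists (u, v); rewrite ?inE.
  by rewrite !(edgeU _ _ eG) ?set21 ?set22.
have constU u v : (phi u \in U) = (phi v \in U).
  have cl : closed (@adj G) [pred w | phi w \in U] by move=> a b /adjU.
  exact: closed_connect cl _ _ (Gconn u v).
(* The edges cannot all be sent into a family F of fewer sets. *)
have edgeF i (F : {set {set T}}) : #|F| < #|edges G| ->
    (forall e, e \in edges G -> (g e \in F1) = i -> g e \in F) ->
    exists2 e, e \in edges G & (g e \in F1) != i.
  move=> Flt gi; have /subsetPn[e eG] : ~~ (edges G \subset g @^-1: F).
    apply/negP => gE; move: Flt; rewrite ltnNge => /negP; apply.
    rewrite -(card_in_imset ginj); apply: subset_leq_card.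
    by apply/subsetP => _ /imsetP[e eG ->]; move/subsetP/(_ e eG): gE; rewrite inE.
  rewrite inE => geF; exists e => //.
  by apply: contraNneq geF => /(gi e eG).
have [e1 e1G ge1] := edgeF true F1 F1lt (fun e _ h => h).
have [|e2 e2G ge2] := edgeF false F2 F2lt.
  by move=> e eG ge; have := gF e eG; rewrite ge.
case/imsetP: (e1G) => -[u1 v1] _ e1E; case/imsetP: (e2G) => -[u2 v2] _ e2E.
move: ge1 ge2; rewrite -(edgeU e1 u1) ?e1E ?set21 -?e1E // -(edgeU e2 u2) ?e2E ?set21 -?e2E //.
by rewrite (constU u1 u2); case: (_ \in U).
Qed.

(** * Symmetric chain decompositions *)

Definition covers {T : finType} (A B : {set T}) := (B \subset A) && (#|A| == #|B|.+1).

(** The largest set comes first: extending a chain at its top is then a cons.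
    The sizes of the two ends add up to the size of S, so that the chain
    crosses the middle level of the subsets of S. *)
Definition symmetric_chain {T : finType} (S : {set T}) (c : seq {set T}) : bool :=
  if c is A :: s then path covers A s && (#|A| + #|last A s| == #|S|) else false.

Lemma path_covers_subset (T : finType) (A : {set T}) s B :
  path covers A s -> B \in A :: s -> B \subset A.
Proof.
elim: s A => [|C s IHs] A /=; first by rewrite inE => _ /eqP ->.
rewrite inE => /andP[/andP[CA _] Cs] /predU1P[-> //|Bs].
exact: subset_trans (IHs _ Cs Bs) CA.
Qed.

Lemma symmetric_chain_comparable (T : finType) (S : {set T}) c A B :
  symmetric_chain S c -> A \in c -> B \in c -> (A \subset B) || (B \subset A).
Proof.
case: c => // C s /= /andP[+ _].
elim: s C => [|D s IHs] C Cs.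
  by rewrite !inE => /eqP -> /eqP ->; rewrite subxx.
move=> Ac Bc; move: (Ac) (Bc); rewrite inE [_ \in C :: _]inE.
case/predU1P => [->|As]; first by rewrite (path_covers_subset _ _ _ _ Cs Bc) orbT.
case/predU1P => [->|Bs]; first by rewrite (path_covers_subset _ _ _ _ Cs Ac).
by apply: (IHs D) => //; case/andP: Cs.
Qed.

Lemma symmetric_chain_middle (T : finType) (S : {set T}) c :
  symmetric_chain S c -> has (fun A : {set T} => #|A| == #|S|./2) c.
Proof.
case: c => // A s /= /andP[As /eqP cS].
have: #|last A s| <= #|S|./2 <= #|A|.
  have : #|last A s| <= #|A|.
    by rewrite subset_leq_card // (path_covers_subset _ _ _ _ As) // mem_last.
  lia.
move: (_./2) => h {cS}.
elim: s A As => [|B s IHs] A /=; first by rewrite orbF; lia.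
move=> /andP[/andP[_ /eqP AB] /IHs{}IHs] /andP[lh hA].
by case: eqVneq => //= Ah; apply: IHs; lia.
Qed.

(** By induction on S (de Bruijn, Tengbergen and Kruyswijk).  When x is added
    to S, a chain A_0 < ... < A_m is replaced by the two chains
    A_0 < ... < A_m < A_m + x and A_0 + x < ... < A_(m-1) + x, the second one
    being dropped when it is empty. *)
Lemma symmetric_chain_decomposition (T : finType) (S : {set T}) :
  exists CC : seq (seq {set T}),
    [/\ uniq (flatten CC), flatten CC =i powerset S & all (symmetric_chain S) CC].
Proof.
have [n] := ubnP #|S|; elim: n S => // n IHn S Sn; have [->|[x xS]] := set_0Vmem S.
  exists [:: [:: set0]].
  by split=> // [A|]; rewrite /= ?powerset0 ?inE // cards0.
have [|CC [uC memC /allP symC]] := IHn (S :\ x).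
  by have := cardsD1 x S; rewrite xS; lia.
have xC A : A \in flatten CC -> x \notin A.
  by rewrite memC inE => /subsetP AS; apply/negP => /AS; rewrite setD11.
pose add_x c := [seq x |: A | A <- c : seq {set T}].
pose extend c := if c is A :: s then (x |: A) :: A :: s else [::].
exists (map extend CC ++ [seq c <- map (add_x \o behead) CC | c != [::]]).
have flattenE : perm_eq
    (flatten (map extend CC ++ [seq c <- map (add_x \o behead) CC | c != [::]]))
    (flatten CC ++ add_x (flatten CC)).
  apply/permP => p; rewrite flatten_cat !count_cat.
  rewrite /add_x; elim: (CC) => //= -[|A s] CC' //= IH; rewrite map_cat.
  by case: eqP => [->|_] /=; rewrite !count_cat /= ?count_cat; lia.
have add_xK A : A \in flatten CC -> (x |: A) :\ x = A.
  by move=> /xC; apply: setU1K.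
split.
- rewrite (perm_uniq flattenE) cat_uniq uC /= map_inj_in_uniq ?uC ?andbT; last first.
    by move=> A B /add_xK {2}<- /add_xK {2}<- ->.
  apply/hasPn => _ /mapP[A _ ->]; apply/negP => /xC.
  by rewrite setU11.
- move=> A; rewrite (perm_mem flattenE) mem_cat memC !inE; apply/orP/idP => [[AS|/mapP[B + ->]]|AS].
  + exact: subset_trans AS (subD1set _ _).
  + rewrite memC inE => BS; rewrite subUset sub1set xS.
    exact: subset_trans BS (subD1set _ _).
  + have [xA|xA] := boolP (x \in A); [right|left]; last by rewrite subsetD1 AS.
    by apply/mapP; exists (A :\ x); rewrite ?setD1K // memC inE setSD.
- rewrite all_cat; apply/andP; split; apply/allP => c.
    case/mapP => -[|A s] sCC ->; first by have := symC _ sCC.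
    have := symC _ sCC; rewrite /= -andbA => /andP[-> /eqP As].
    have xA : x \notin A by apply: xC; apply/flattenP; exists (A :: s); rewrite ?mem_head.
    by rewrite /covers subsetUr cardsU1 xA (cardsD1 x S) xS /=; lia.
  rewrite mem_filter => /andP[+ /mapP[c' cCC cE]]; rewrite cE.
  case: c' {cE} cCC => // A [|B s] // sCC _ /=.
  have /= /andP[/andP[/andP[_ /eqP AB] Bs] /eqP As] := symC _ sCC.
  have xBs C : C \in B :: s -> x \notin C.
    by move=> Cs; apply: xC; apply/flattenP; exists (A :: B :: s); rewrite // inE Cs orbT.
  rewrite last_map !cardsU1 !xBs ?mem_head ?mem_last // (cardsD1 x S) xS.
  apply/andP; split; last by rewrite -As AB !add1n addnS.
  rewrite path_map; apply: sub_in_path Bs; last exact/allP/xBs.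
  move=> C D /= xC' xD /andP[DC /eqP CD].
  rewrite -!topredE /= in xC' xD.
  by rewrite /covers setUS // !cardsU1 xC' xD CD /=.
Qed.

(** A chain decomposition in a form free of lists: [mid A] is the member of
    middle size of the chain of A.  It identifies the chain, so the number of
    chains is bounded by the size of the middle level. *)
Lemma symmetric_chain_middle_map (T : finType) (S : {set T}) :
  exists mid : {set T} -> {set T},
    [/\ forall A : {set T}, A \subset S -> mid A \subset S /\ #|mid A| = #|S|./2 &
        forall A B : {set T}, A \subset S -> B \subset S -> mid A = mid B ->
          (A \subset B) || (B \subset A)].
Proof.
have [CC [uC memC /allP symC]] := symmetric_chain_decomposition _ S.
pose chain (A : {set T}) := nth [::] CC (find (fun c => A \in c) CC).
pose mid A := nth set0 (chain A) (find (fun B : {set T} => #|B| == #|S|./2) (chain A)).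
have chainP (A : {set T}) : A \subset S -> A \in chain A /\ chain A \in CC.
  move=> AS; have : A \in flatten CC by rewrite memC inE.
  case/flattenP => c cCC Ac.
  have hasA : has (fun c => A \in c) CC by apply/hasP; exists c.
  by split; [exact: (nth_find [::] hasA) | rewrite mem_nth -?has_find].
have midP (A : {set T}) : A \subset S -> mid A \in chain A /\ #|mid A| = #|S|./2.
  move=> AS; have [_ /symC/symmetric_chain_middle hasm] := chainP A AS.
  by split; [rewrite mem_nth -?has_find | apply/eqP/(nth_find set0 hasm)].
have uniq_chain c c' (A : {set T}) : c \in CC -> c' \in CC -> A \in c -> A \in c' -> c = c'.
  move: uC; elim: (CC) => //= c0 CC' IH; rewrite cat_uniq => /and3P[_ /hasPn dis uC'].
  have c0x d : d \in CC' -> A \in d -> A \notin c0.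
    by move=> dC Ad; apply: dis; apply/flattenP; exists d.
  rewrite !inE => /predU1P[->|cC] /predU1P[->|c'C] // Ac Ac'; last exact: IH.
    by have := c0x _ c'C Ac'; rewrite Ac.
  by have := c0x _ cC Ac; rewrite Ac'.
exists mid; split=> [A AS|A B AS BS mAB].
  have [mA cm] := midP A AS; split=> //; have [_ cA] := chainP A AS.
  by have := memC (mid A); rewrite inE => <-; apply/flattenP; exists (chain A).
have [Ac cA] := chainP A AS; have [Bc cB] := chainP B BS.
have [mA _] := midP A AS; have [mB _] := midP B BS.
apply: (symmetric_chain_comparable _ S (chain A)) => //; first exact: symC.
by rewrite (uniq_chain _ _ (mid A) cA cB) // mAB.
Qed.

(** * Coloring by chains *)

Lemma f_berge_coloring (n : nat) (G : sgraph) (C : finType) (col : {set 'I_n} -> C) :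
  1 < #|edges G| -> (forall c, berge_free G [set A | col A == c]) ->
  f_berge n G <= #|[set col A | A : {set 'I_n}]|.
Proof.
move=> G2 colG; have [_ fmin] := f_bergeP n G2.
have sub : preim_partition col [set: {set 'I_n}] \subset
    [set [set A | col A == c] | c in [set col A | A : {set 'I_n}]].
  apply/subsetP => _ /imsetP[A _ ->]; apply/imsetP.
  exists (col A); first exact: imset_f.
  by apply/setP => B; rewrite !inE eq_sym.
apply: leq_trans (leq_trans (subset_leq_card sub) (leq_imset_card _ _)).
apply: fmin; rewrite /free_coloring preim_partitionP.
by apply/forall_inP => F /(subsetP sub)/imsetP[c _ ->].
Qed.

Section Coloring.

Context {n : nat} (d : nat) (x0 : 'I_n) (mid : {set 'I_n} -> {set 'I_n}).
Hypothesis d_gt0 : 0 < d.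
Let S := [set~ x0].
Local Notation color := ({set 'I_n} * 'I_(#|{set 'I_n}|.+2))%type.
Implicit Types A B : {set 'I_n}.
Hypothesis midS : forall A : {set 'I_n}, A \subset S -> mid A \subset S /\ #|mid A| = #|S|./2.
Hypothesis mid_comparable : forall A B : {set 'I_n}, A \subset S -> B \subset S ->
  mid A = mid B -> (A \subset B) || (B \subset A).

Definition chain (c : {set 'I_n}) := [set B in powerset S | mid B == c].

Definition rank A := #|[set B in chain (mid A) | B \proper A]|.

Lemma rank_proper A B : A \subset S -> mid A = mid B -> A \proper B ->
  rank A < rank B.
Proof.
move=> AS mAB AB; apply: proper_card; apply/properP; split.
  apply/subsetP => C; rewrite !inE mAB => /andP[-> /=] CA.
  exact: proper_trans CA AB.
by exists A; rewrite !inE ?AS ?mAB ?eqxx ?AB // properxx andbF.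
Qed.

Lemma rank_le_subset A B : A \subset S -> B \subset S -> mid A = mid B ->
  rank A <= rank B -> A \subset B.
Proof.
move=> AS BS mAB; apply: contraLR => AB; rewrite -ltnNge.
apply: rank_proper => //; rewrite properE AB andbT.
by have := mid_comparable _ _ AS BS mAB; rewrite (negPf AB).
Qed.

Lemma rank_lt A : A \subset S -> rank A < #|chain (mid A)|.
Proof.
move=> AS; apply: proper_card; apply/properP; split.
  by apply/subsetP => B; rewrite inE => /andP[].
by exists A; rewrite !inE ?AS ?eqxx // properxx andbF.
Qed.

Definition core A := if x0 \in A then ~: A else A.
(** Blocks of d consecutive members along a chain.  Passing from sets to
    complements, the blocks are shifted by one member and one level, so that the
    lowest of the complemented sets of some level contains the highest of the
    other sets of that level. *)
Definition level A := if x0 \in A then (rank (core A)).+1 %/ d else (rank (core A) %/ d).+1.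
(** [inord] is harmless, as a level never exceeds the number of sets by more
    than one; see [chain_color_level]. *)
Definition chain_color A : color := (mid (core A), inord (level A)).

Lemma core_subset A : core A \subset S.
Proof.
rewrite /core; case: ifP => [xA|/negbT xA].
  by rewrite setCS sub1set.
by rewrite -[A]setCK setCS sub1set inE.
Qed.

Lemma level_le A : level A <= (#|chain (mid (core A))| %/ d).+1.
Proof.
have r := rank_lt _ (core_subset A).
by rewrite /level; case: ifP => _; rewrite ?ltnS ?leq_div2r // ?leqW ?leq_div2r // ltnW.
Qed.

Lemma chain_color_level A : (chain_color A).2 = level A :> nat.
Proof.
rewrite /= inordK // ltnS (leq_trans (level_le A)) // ltnS.
by rewrite (leq_trans (leq_div _ _)) // max_card.
Qed.

(** On one side of x0, a color fixes the chain and the quotient by d of the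
    rank (or of its successor), so the remainder determines the set. *)
Lemma card_color_half (b : bool) (c : color) :
  #|[set A | (chain_color A == c) && ((x0 \in A) == b)]| <= d.
Proof.
(* The type with d elements is written with [d.-1.+1], as required by [inord]. *)
pose r A := inord (if b then (rank (core A)).+1 %% d else rank (core A) %% d) : 'I_d.-1.+1.
rewrite -[leqRHS](prednK d_gt0) -[leqRHS]card_ord.
rewrite -(card_in_imset (f := r)) ?max_card // => A B.
rewrite !inE => /andP[/eqP cA /eqP xA] /andP[/eqP cB /eqP xB] /(congr1 val).
rewrite /= !inordK ?prednK //; try by case: b {r xA xB}; rewrite ltn_mod.
move=> rAB; have [mAB lAB] : mid (core A) = mid (core B) /\ level A = level B.
  by move: cA; rewrite -cB => cAB; rewrite -!chain_color_level cAB; case: cAB.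
have {rAB lAB} rAB : rank (core A) = rank (core B).
  move: rAB lAB; rewrite /level xA xB; case: (b) => rAB.
    move=> lAB; apply: succn_inj.
    by rewrite (divn_eq (rank _).+1 d) lAB rAB -divn_eq.
  by move=> [lAB]; rewrite (divn_eq (rank _) d) lAB rAB -divn_eq.
have cAB : core A = core B.
  have subAB C D : mid (core C) = mid (core D) -> rank (core C) = rank (core D) ->
      core C \subset core D.
    by move=> mCD rCD; apply: rank_le_subset; rewrite ?core_subset ?rCD.
  by apply/eqP; rewrite eqEsubset; apply/andP; split; apply: subAB.
by move: cAB; rewrite /core xA xB; case: (b) => // /setC_inj.
Qed.

(** If A avoids x0, B contains x0 and they share a color, then
    rank A / d + 1 = (rank (~: B) + 1) / d, whence rank A <= rank (~: B).  In a
    chain this means that A is a subset of ~: B. *)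
Lemma chain_color_free (G : sgraph) (c : color) :
  connected_graph G -> #|edges G| = d.+1 ->
  berge_free G [set A | chain_color A == c].
Proof.
move=> Gc Gd.
have -> : [set A | chain_color A == c] =
    [set A | (chain_color A == c) && ((x0 \in A) == false)] :|:
    [set A | (chain_color A == c) && ((x0 \in A) == true)].
  by apply/setP => A; rewrite !inE -andb_orr; case: (x0 \in A); rewrite andbT.
apply: berge_free_disjointU; rewrite ?Gd ?ltnS ?card_color_half // => A B.
rewrite !inE => /andP[/eqP cA /eqP xA] /andP[/eqP cB /eqP xB].
have [mAB lAB] : mid (core A) = mid (core B) /\ level A = level B.
  by move: cA; rewrite -cB => cAB; rewrite -!chain_color_level cAB; case: cAB.
have : core A \subset core B.
  apply: rank_le_subset; rewrite ?core_subset ?mAB //.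
  move: lAB; rewrite /level xA xB => lAB.
  have := ltn_ceil (rank (core A)) d_gt0; rewrite lAB => /leq_trans.
  by move=> /(_ _ (leq_divM _ _)); rewrite ltnS.
by rewrite /core xA xB -disjoints_subset.
Qed.

(** A chain with m members has levels 0, ..., m / d + 1, and the numbers m add
    up to the number of sets avoiding x0. *)
Lemma card_chain_color : d * #|[set chain_color A | A : {set 'I_n}]| <=
  2 ^ n.-1 + 2 * d * 'C(n.-1, n.-1./2).
Proof.
have cardS : #|S| = n.-1 by rewrite cardsC1 card_ord.
pose L := [set c in powerset S | #|c| == n.-1./2].
have cardL : #|L| = 'C(n.-1, n.-1./2).
  by rewrite -cardS -cards_draws; apply: eq_card => c; rewrite !inE cardS.
have midL A : A \subset S -> mid A \in L.
  by move=> AS; have [mS mc] := midS _ AS; rewrite !inE mS mc cardS eqxx.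
rewrite -sum1_card (partition_big fst (mem L)) /=; last first.
  by move=> _ /imsetP[A _ ->]; rewrite midL // core_subset.
have fiber c : c \in L ->
    \sum_(y in [set chain_color A | A : {set 'I_n}] | y.1 == c) 1 <= #|chain c| %/ d + 2.
  move=> cL; rewrite sum1dep_card addn2 -[leqRHS]card_ord.
  rewrite -(card_in_imset (f := fun y : color => inord y.2 : 'I_(#|chain c| %/ d).+2)) ?max_card //.
  have lt2 (y : color) : y \in [set y in [set chain_color A | A : {set 'I_n}] | y.1 == c] ->
      y.2 < (#|chain c| %/ d).+2 /\ y.1 = c.
    rewrite inE => /andP[/imsetP[A _ ->] /eqP <-]; split=> //.
    by rewrite chain_color_level ltnS level_le.
  move=> [y1 y2] [z1 z2] /lt2[/= y2lt ->] /lt2[/= z2lt ->] /(congr1 val).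
  by rewrite /= !inordK // => /val_inj ->.
apply: leq_trans (leq_mul (leqnn d) (leq_sum _ fiber)) _.
rewrite big_split /= sum_nat_const cardL mulnDr leq_add //; last by lia.
rewrite big_distrr /= -cardS -card_powerset -sum1_card.
rewrite [leqRHS](partition_big mid (mem L)) /=; last first.
  by move=> A; rewrite powersetE; apply: midL.
apply: leq_sum => c cL; rewrite sum1dep_card mulnC.
exact: leq_divM.
Qed.

End Coloring.

Lemma f_berge_bound (n d : nat) (G : sgraph) : 0 < d -> connected_graph G ->
  #|edges G| = d.+1 -> d * f_berge n.+1 G <= 2 ^ n + 2 * d * 'C(n, n./2).
Proof.
move=> d0 Gc Gd; have [mid [midS midC]] := symmetric_chain_middle_map _ [set~ (ord0 : 'I_n.+1)].
apply: leq_trans (card_chain_color d ord0 mid d0 midS).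
rewrite leq_mul2l; apply/orP; right.
apply: f_berge_coloring => [|c]; first by rewrite Gd.
exact: (chain_color_free d ord0 mid d0 midC).
Qed.

(** Used for n = 0, where no point x0 exists. *)
Lemma f_berge_le_card (n : nat) (G : sgraph) : 1 < #|edges G| -> f_berge n G <= 2 ^ n.
Proof.
move=> G2; have [_ fmin] := f_bergeP n G2.
apply: leq_trans (fmin _ (discrete_coloring_free _ G2)) _.
apply: leq_trans (leq_imset_card _ _) _.
by rewrite -cardsT -powersetT card_powerset cardsT card_ord.
Qed.

(** * Size of the middle level and conclusion *)

(** Induction on m through the pair of levels 2m and 2m+1: the central
    coefficient is multiplied by (2m+1) / (m+1) and then by 2.  The factor n + 1
    is absorbed because (2m+1) (2m+3) <= (2m+2)^2. *)
Lemma central_binomial_le (n : nat) : n.+1 * 'C(n, n./2) ^ 2 <= 4 ^ n.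
Proof.
have sym m : 'C(m.*2.+1, m.+1) = 'C(m.*2.+1, m).
  by rewrite -bin_sub ?subSS; [congr 'C(_, _); lia | lia].
have odd_step m X : m.*2.+1 * 'C(m.*2, m) ^ 2 <= X ->
    m.*2.+3 * 'C(m.*2.+1, m) ^ 2 <= 4 * X.
  have := mul_bin_diag m.*2.+1 m; rewrite sym /= => ab aX.
  rewrite -(leq_pmul2l (m := m.+1 ^ 2)) //.
  have -> : m.+1 ^ 2 * (m.*2.+3 * 'C(m.*2.+1, m) ^ 2) =
      m.*2.+3 * m.*2.+1 * (m.*2.+1 * 'C(m.*2, m) ^ 2).
    have -> : m.+1 ^ 2 * (m.*2.+3 * 'C(m.*2.+1, m) ^ 2) =
        m.*2.+3 * (m.+1 * 'C(m.*2.+1, m)) ^ 2 by lia.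
    by rewrite -ab; lia.
  apply: leq_trans (leq_mul (leqnn _) aX) _; nia.
have even_case m : m.*2.+1 * 'C(m.*2, m) ^ 2 <= 4 ^ m.*2.
  elim: m => [|m IHm]; first by rewrite bin0.
  have -> : 'C(m.+1.*2, m.+1) = 2 * 'C(m.*2.+1, m).
    by rewrite doubleS binS sym addnn mul2n.
  rewrite doubleS expnMn 2![4 ^ _.+1]expnS.
  rewrite mulnCA; apply: leq_mul => //; exact: odd_step.
rewrite -[n in n.+1 * _]odd_double_half -[n in 'C(n, _)]odd_double_half.
rewrite -[in leqRHS](odd_double_half n).
case: (odd n); rewrite ?add1n ?add0n // [4 ^ _.+1]expnS.
by apply: leq_trans (odd_step _ _ (even_case _)); rewrite leq_mul2r leqnSn orbT.
Qed.

End SetFamilies.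

Lemma central_binomial_le_sqrt (R : realType) (n : nat) :
  'C(n, n./2)%:R <= 2 ^+ n / Num.sqrt n.+1%:R :> R.
Proof.
have n0 : (0 : R) < n.+1%:R by rewrite ltr0n.
rewrite ler_pdivlMr ?sqrtr_gt0 // -ler_sqr ?nnegrE ?mulr_ge0 ?sqrtr_ge0 ?exprn_ge0 //.
rewrite exprMn sqr_sqrtr ?(ltW n0) // -exprM mulnC exprM mulrC.
rewrite -!natrX -natrM ler_nat.
exact: central_binomial_le.
Qed.

Theorem theorem3 (R : realType) (k : nat) (hk : (2 <= k)%N) :
  exists h : nat -> R,
    h =O_\oo (fun n : nat => 1 / Num.sqrt (n%:R : R)) /\
    forall G : sgraph, connected_graph G -> #|edges G| = k ->
    forall n : nat,
      (f_berge n G)%:R <= 2 ^+ n / (2 * (k%:R - 1)) * (1 + h n).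
Proof.
case: k hk => [//|d]; rewrite ltnS => d0.
(* At n = 0 the reciprocal of the square root is 0, which would make the bound
   smaller than 1; any value from 2 d - 1 on is large enough there. *)
exists (fun n => if n is 0 then 2 * d%:R else 2 * d%:R / Num.sqrt n%:R); split.
  apply/eqO_exP; exists (2 * d%:R); first by rewrite mulr_gt0 ?ltr0n.
  exists 1%N => // -[//|n] _ /=.
  by rewrite div1r normrM ger0_norm // mulr_ge0 ?ler0n.
move=> G Gc Gd n; rewrite -(natr1 d) addrK.
have dR : (0 : R) < d%:R by rewrite ltr0n.
case: n => [|n].
  have f1 : (f_berge 0 G)%:R <= 1 :> R.
    by rewrite (ler_nat R _ 1) f_berge_le_card // Gd.
  apply: le_trans f1 _; rewrite expr0 mulrAC mul1r ler_pdivlMr; last by lra.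
  by have : (1 : R) <= d%:R; [rewrite ler1n | lra].
have := f_berge_bound n d G d0 Gc Gd; rewrite -(ler_nat R) natrD !natrM natrX => fb.
have cb := central_binomial_le_sqrt R n.
rewrite -(ler_pM2l dR); apply: le_trans fb _.
have {}cb := ler_wpM2l (_ : 0 <= 2%:R * d%:R) cb.
apply: le_trans (lerD (lexx _) (cb _)) _; first by rewrite mulr_ge0 ?ler0n.
have s0 : Num.sqrt n.+1%:R != 0 :> R by rewrite gt_eqF ?sqrtr_gt0 ?ltr0n.
move: s0; move: (Num.sqrt _) => s s0; rewrite exprS.
rewrite le_eqVlt; apply/orP; left; apply/eqP; field.
by rewrite s0 gt_eqF.
Qed.
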